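(* Let $X$ be a complex Banach space, and let $(A,A(\cdot))$ and $(B,B(\cdot))$ be two pairs each satisfying conditions (a1)–(a4) listed in the context. Let $\psi\colon\mathbb{D}\to\mathbb{C}$ be an analytic function that is nonzero (i.e. $\psi(z)\neq 0$ for some $z\in\mathbb{D}$) and let $\varphi\colon\mathbb{D}\to\mathbb{D}$ be analytic. Let $W_{\psi,\varphi}$ and $\widetilde{W}_{\psi,\varphi}$ denote the weighted composition operators $f\mapsto\psi\cdot(f\circ\varphi)$ acting on scalar-valued and on $X$-valued analytic functions, respectively. Then $\widetilde{W}_{\psi,\varphi}$ is compact $A(X)\to B(X)$ if and only if $X$ is finite dimensional and $W_{\psi,\varphi}$ is compact $A\to B$.
   Context: $\mathbb{D}$ is the open unit disc in $\mathbb{C}$. For $\psi\colon\mathbb{D}\to\mathbb{C}$ analytic and $\varphi\colon\mathbb{D}\to\mathbb{D}$ analytic, the weighted composition operator is $f\mapsto\psi\cdot(f\circ\varphi)$, i.e. $z\mapsto\psi(z)f(\varphi(z))$; it is written $W_{\psi,\varphi}$ on scalar-valued analytic functions and $\widetilde{W}_{\psi,\varphi}$ on $X$-valued analytic functions. ''Compact $A\to B$'' means that the operator maps $A$ into $B$ and is a compact linear operator between them. A pair $(A,A(\cdot))$ consists of a Banach space $A$ of analytic functions $\mathbb{D}\to\mathbb{C}$ and, for each complex Banach space $X$, an associated Banach space $A(X)$ of analytic functions $\mathbb{D}\to X$. The following conditions are required for all complex Banach spaces $X$: (a1) The constant maps $f(z)\equiv c$ belong to $A$ for all $c\in\mathbb{C}$.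 (a2) For every $x\in X$, $f\mapsto f\otimes x$ defines a bounded linear operator $A\to A(X)$, where $(f\otimes x)(z)=f(z)x$. (a3) For every $x^*\in X^*$, $f\mapsto x^*\circ f$ defines a bounded linear operator $A(X)\to A$. (a4) For every $z\in\mathbb{D}$, the point evaluation $f\mapsto f(z)$ is bounded $A(X)\to X$.
   Formalization: X is assumed to be a nonzero Banach space: for X = {0} the vector-valued operator is trivially compact while the scalar operator need not be (e.g. A = B = H^∞, ψ = 1, φ = id), so the equivalence fails there. *)

(* Defs.v *)
From HB Require Import structures.
From mathcomp Require Import all_boot all_order all_algebra.
From mathcomp Require Import complex.
From mathcomp Require Import all_classical all_reals all_analysis.
Set Implicit Arguments.
Unset Strict Implicit.
Unset Printing Implicit Defensive.
Import Order.TTheory GRing.Theory Num.Theory.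
Import numFieldNormedType.Exports.
Local Open Scope classical_set_scope.
Local Open Scope ring_scope.

(* Complex normed spaces are [normedModType R[i]]; the library then gives the
   norm values in [R[i]], where [<=] and [<] hold only between numbers that
   differ by a real.  Scalar-valued functions take values in the regular
   module [R[i]^o], so that they are covered by the vector-valued notions. *)

Definition disc (R : realType) : Type := {z : R[i] | `|z| < 1}.

Definition analytic (R : realType) (X : normedModType R[i])
    (f : disc R -> X) : Prop :=
  forall z0 : disc R, exists (r : R[i]) (a : nat -> X), 0 < r /\
    forall z : disc R, `|val z - val z0| < r ->
      series (fun n => (val z - val z0) ^+ n *: a n) @ \oo --> f z.

Definition bounded_op (R : realType) (V W : normedModType R[i])
    (T : V -> W) : Prop :=
  exists M : R[i], forall v, `|T v| <= M * `|v|.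

Definition compact_op (R : realType) (V W : normedModType R[i])
    (T : V -> W) : Prop :=
  precompact (T @` [set v | `|v| <= 1]).

Definition finite_dimensional (R : realType) (X : normedModType R[i]) : Prop :=
  exists (n : nat) (e : 'I_n -> X),
    forall x : X, exists c : 'I_n -> R[i], x = \sum_(i < n) c i *: e i.

(* A Banach space of analytic functions is a Banach space together with an
   injective linear realization of its elements as functions on the disc; its
   norm need not be related to any topology on the functions. *)
Record analyticBanachSpace (R : realType) (X : normedModType R[i]) := {
  abs_sort :> completeNormedModType R[i];
  abs_fun : {linear abs_sort -> (disc R -> X)};
  abs_fun_inj : injective abs_fun;
  abs_fun_analytic : forall f, analytic (abs_fun f)
}.

(* A pair (A, A(.)).  A and A(C) are not required to agree. *)
Record spacePair (R : realType) := {
  scalarSpace : analyticBanachSpace R[i]^o;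
  vectorSpace : forall X : completeNormedModType R[i], analyticBanachSpace X
}.

Definition admissible (R : realType) (P : spacePair R) : Prop :=
  let A := scalarSpace P in
  (forall c : R[i]^o, exists f : A, forall z, abs_fun A f z = c) /\
  forall X : completeNormedModType R[i],
    let AX := vectorSpace P X in
    [/\ forall x : X, exists T : {linear A -> AX},
          bounded_op T /\
          forall f z, abs_fun AX (T f) z = abs_fun A f z *: x,
        forall x' : {linear X -> R[i]^o}, bounded_op x' ->
          exists T : {linear AX -> A},
            bounded_op T /\
            forall f z, abs_fun A (T f) z = x' (abs_fun AX f z)
      & forall z, bounded_op (fun f : AX => abs_fun AX f z)].

(* Since [abs_fun F] is injective, the existence of [T] says that the weighted
   composition operator maps E into F, and [T] is then unique. *)
Definition wcomp_compact (R : realType) (X : normedModType R[i])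
    (psi : disc R -> R[i]^o) (phi : disc R -> disc R)
    (E F : analyticBanachSpace X) : Prop :=
  exists T : {linear E -> F},
    (forall f z, abs_fun F (T f) z = psi z *: abs_fun E f (phi z)) /\
    compact_op T.

(* Main.v *)
(* If the vector-valued operator W~ is compact, choose z0 with psi z0 != 0 and,
   for each x, let S x be the constant function x.  The sets {x | |S x| <= n}
   cover X, and each is precompact because W~ (S x) takes the value psi z0 *: x
   at z0.  By Baire one of them is dense in a ball, so X is finite dimensional;
   no bound on S is needed.  If x' is a bounded functional with x' x = 1, then
   the scalar operator is g |-> x' o W~ (g (x) x).
   Conversely, with coordinates x = \sum_i f_i x *: e_i on X, the vector-valued
   operator is the finite sum of the operators g |-> W (f_i o g) (x) e_i.
   The bounded functionals come from the coordinates of a finite-dimensional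
   space, so the Hahn-Banach theorem is not needed. *)

Require Import Defs.
From HB Require Import structures.
From mathcomp Require Import all_boot all_order all_algebra.
From mathcomp Require Import complex.
From mathcomp Require Import all_classical all_reals all_analysis.
From mathcomp Require Import ring lra.
Set Implicit Arguments.
Unset Strict Implicit.
Unset Printing Implicit Defensive.
Import Order.TTheory GRing.Theory Num.Theory.
Import numFieldNormedType.Exports.
Local Open Scope classical_set_scope.
Local Open Scope ring_scope.
Local Open Scope complex_scope.

(** * Real-valued norms and convergence of sequences *)

(* The norm of [V] lies in [R[i]], which is only partially ordered. *)
Definition rnorm (R : realType) (V : normedModType R[i]) (v : V) : R :=
  complex.Re `|v|.

Section RealNorm.
Variables (R : realType) (V : normedModType R[i]).
Implicit Types u v w : V.

Lemma rnormE v : `|v| = (rnorm v)%:C.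
Proof. by rewrite /rnorm RRe_real// ger0_real. Qed.

Lemma rnorm_ge0 v : 0 <= rnorm v.
Proof. by rewrite -ler0c -rnormE. Qed.

Lemma rnormD u v : rnorm (u + v) <= rnorm u + rnorm v.
Proof. by rewrite -lecR rmorphD/= -!rnormE ler_normD. Qed.

Lemma rnormN v : rnorm (- v) = rnorm v.
Proof. by rewrite /rnorm normrN. Qed.

Lemma rnorm_distC u v : rnorm (u - v) = rnorm (v - u).
Proof. by rewrite -rnormN opprB. Qed.

Lemma rnorm_tri u v w : rnorm (u - w) <= rnorm (u - v) + rnorm (v - w).
Proof. by rewrite (le_trans _ (rnormD _ _))// addrA subrK. Qed.

Lemma rnorm0 : rnorm (0 : V) = 0.
Proof. by rewrite /rnorm normr0. Qed.

Lemma rnorm_eq0 v : (rnorm v == 0) = (v == 0).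
Proof. by rewrite -[RHS]normr_eq0 rnormE eq_complex/= eqxx andbT. Qed.

Lemma cvg_rnormP (u : nat -> V) l :
  u @ \oo --> l <->
  forall e : R, 0 < e -> exists K, forall k, (K <= k)%N -> rnorm (l - u k) < e.
Proof.
split=> [/cvgrPdist_lt ul e e0|ul].
  have [K _ HK] : \forall k \near \oo, `|l - u k| < e%:C.
    by apply: ul; rewrite ltcR.
  by exists K => k /HK/=; rewrite rnormE ltcR.
apply/cvgrPdist_lt => e e0.
(* A positive element of [R[i]] is real, so complex radii reduce to real ones. *)
have eE : e = (complex.Re e)%:C by rewrite RRe_real// gtr0_real.
have [|K HK] := ul (complex.Re e); first by rewrite -ltcR -eE.
by exists K => // k /= /HK; rewrite rnormE eE ltcR.
Qed.

End RealNorm.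

Lemma rnormZ (R : realType) (V : normedModType R[i]) (c : R[i]) (v : V) :
  rnorm (c *: v) = rnorm (c : R[i]^o) * rnorm v.
Proof.
by apply: complexI; rewrite rmorphM /= -!rnormE normrZ.
Qed.

Lemma rnorm_real (R : realType) (x : R) : rnorm (x%:C : R[i]^o) = `|x|.
Proof. by rewrite /rnorm normc_def/= expr0n addr0 sqrtr_sqr. Qed.

Lemma rnorm_cauchy_cvg (R : realType) (V : completeNormedModType R[i])
    (u : nat -> V) :
  (forall e : R, 0 < e -> exists K, forall k l, (K <= k)%N -> (K <= l)%N ->
     rnorm (u k - u l) < e) ->
  exists l : V, u @ \oo --> l.
Proof.
move=> cu; apply/cvg_ex; apply/cauchy_cvgP/cauchy_exP => e e0.
have eE : e = (complex.Re e)%:C by rewrite RRe_real// gtr0_real.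
have [|K HK] := cu (complex.Re e); first by rewrite -ltcR -eE.
exists (u K), K => // k /= Kk.
by rewrite -ball_normE /= rnormE eE ltcR HK.
Qed.

(** Real and imaginary parts are dominated by the modulus, hence Cauchy in [R]; their limits
    recombine. *)
Lemma complex_cauchy_cvg (R : realType) (u : nat -> R[i]^o) :
  (forall e : R, 0 < e -> exists K, forall k l, (K <= k)%N -> (K <= l)%N ->
     rnorm (u k - u l) < e) ->
  exists l : R[i]^o, u @ \oo --> l.
Proof.
move=> cu.
have real_cvg (p : {additive R[i] -> R}) :
    (forall x : R[i]^o, `|p x| <= rnorm x) -> exists l : R, p \o u @ \oo --> l.
  move=> ple; apply/cvg_ex; apply/cauchy_cvgP/cauchy_exP => e e0.
  have [K HK] := cu e e0; exists (p (u K)), K => // k /= Kk.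
  by rewrite -ball_normE /= -raddfB (le_lt_trans (ple _))// HK.
have Re_le (x : R[i]^o) : `|complex.Re x| <= rnorm x.
  by rewrite -lecR -rnormE normc_ge_Re.
have [a ua] := real_cvg (@complex.Re R : {additive R[i] -> R}) Re_le.
have Im_le (x : R[i]^o) : `|complex.Im x| <= rnorm x.
  rewrite /rnorm normc_def /= -sqrtr_sqr ler_wsqrtr// lerDr sqr_ge0//.
have [b ub] := real_cvg (@complex.Im R : {additive R[i] -> R}) Im_le.
exists (a +i* b); apply/cvg_rnormP => e e0.
have e2 : 0 < e / 2 by lra.
move/cvgrPdist_lt/(_ _ e2) : ua => [K _ HK].
move/cvgrPdist_lt/(_ _ e2) : ub => [L _ HL].
exists (maxn K L) => k; rewrite geq_max => /andP[Kk Lk].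
have := HK _ Kk; have := HL _ Lk; rewrite /=; case: (u k) => x y /= h1 h2.
have -> : (a +i* b) - (x +i* y) = (a - x)%:C + 'i *: (b - y)%:C :> R[i]^o.
  apply/eqP; rewrite eq_complex /= !(mul0r, mul1r, mulr0, subr0, addr0, add0r).
  by rewrite !eqxx.
rewrite (le_lt_trans (rnormD _ _))// rnormZ !rnorm_real.
have -> : rnorm ('i : R[i]^o) = 1.
  by rewrite /rnorm normc_def /= expr0n/= expr1n add0r sqrtr1.
lra.
Qed.

(** * Bounded coordinates in finite dimension *)

(** By induction: the distance from [e n] to the span of the earlier vectors is at least some
    [d > 0], so [d^-1] controls the last coordinate; subtracting the last term leaves the other
    coordinates to the induction hypothesis. *)
Lemma independent_coords_bounded (R : realType) (V : normedModType R[i])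
    (n : nat) (e : nat -> V) :
  (forall c : nat -> R[i], \sum_(i < n) c i *: e i = 0 ->
     forall i, (i < n)%N -> c i = 0) ->
  exists M : R, forall (c : nat -> R[i]) i, (i < n)%N ->
    rnorm (c i : R[i]^o) <= M * rnorm (\sum_(j < n) c j *: e j).
Proof.
elim: n => [|n IHn] indep; first by exists 0.
have [M HM] : exists M : R, forall (c : nat -> R[i]) i, (i < n)%N ->
    rnorm (c i : R[i]^o) <= M * rnorm (\sum_(j < n) c j *: e j).
  apply: IHn => c c0 i ltin.
  have := indep (fun j => if (j < n)%N then c j else 0).
  rewrite big_ord_recr/= ltnn scale0r addr0.
  under eq_bigr do rewrite ltn_ord.
  by move=> /(_ c0 i (ltnW ltin)); rewrite ltin.
have M_ge0 : 0 <= `|M| by [].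
have {}HM c i : (i < n)%N ->
    rnorm (c i : R[i]^o) <= `|M| * rnorm (\sum_(j < n) c j *: e j).
  move=> ltin; rewrite (le_trans (HM c i ltin))// ler_wpM2r ?rnorm_ge0//.
  exact: ler_norm.
set N := `|M| in M_ge0 HM; clearbody N.
(* Otherwise combinations with coefficients [u k] approach [e n] within 1/(k+1); by the induction
   bound the coefficients are Cauchy, and their limits put [e n] in the span. *)
have [d d0 Hd] : exists2 d : R, 0 < d &
    forall c : nat -> R[i], d <= rnorm (e n - \sum_(i < n) c i *: e i).
  apply: contrapT => noD.
  have approx k : exists c : nat -> R[i],
      rnorm (e n - \sum_(i < n) c i *: e i) < k.+1%:R^-1.
    apply: contrapT => noc; apply: noD; exists k.+1%:R^-1 => // c.
    by rewrite leNgt; apply/negP => h; apply: noc; exists c.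
  have [u Hu] := choice approx.
  have lim i : exists l : R[i]^o,
      (i < n)%N -> (fun k => u k i : R[i]^o) @ \oo --> l.
    have [ltin|] := boolP (i < n)%N; last by exists 0.
    have [|l ul] := @complex_cauchy_cvg R (fun k => u k i); last by exists l.
    move=> eps eps0.
    (* From this index on, (N+1)/(m+1) < eps/2, which serves for each of the two approximation
       errors. *)
    exists (Num.truncn (2 * (N + 1) / eps)) => k l Kk Kl.
    have small m : (Num.truncn (2 * (N + 1) / eps) <= m)%N ->
        (N + 1) * m.+1%:R^-1 < eps / 2.
      move=> Km; rewrite ltr_pdivrMr// -ltr_pdivrMl; last by lra.
      rewrite (_ : _^-1 * _ = 2 * (N + 1) / eps); last first.
        by field; rewrite gt_eqF.
      by rewrite (lt_le_trans (truncnS_gt _))// ler_nat ltnS.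
    have := HM (fun j => u k j - u l j) i ltin => /= /le_lt_trans; apply.
    have -> : \sum_(j < n) (u k j - u l j) *: e j =
        (e n - \sum_(j < n) u l j *: e j) - (e n - \sum_(j < n) u k j *: e j).
      under eq_bigr do rewrite scalerBl.
      by rewrite sumrB opprB [RHS]addrC addrA subrK.
    have h1 : N * rnorm (e n - \sum_(j < n) u l j *: e j -
        (e n - \sum_(j < n) u k j *: e j)) <=
        (N + 1) * (l.+1%:R^-1 + k.+1%:R^-1).
      apply: ler_pM => //; [exact: rnorm_ge0|lra|].
      by rewrite (le_trans (rnormD _ _))// rnormN lerD// ltW.
    by rewrite (le_lt_trans h1)// mulrDr [ltRHS]splitr ltrD ?small.
  have [a Ha] := choice lim.
  have ea : e n = \sum_(i < n) a i *: e i.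
    apply/eqP; rewrite -subr_eq0 -rnorm_eq0 eq_le rnorm_ge0 andbT.
    have ua : (fun k => \sum_(i < n) u k i *: e i) @ \oo -->
        \sum_(i < n) (a i : R[i]) *: e i.
      apply: (cvg_big (op := +%R)) => [|i _]; first exact: add_continuous.
      apply: cvgZr_tmp.
      by apply: Ha.
    apply/ler_addgt0Pl => eps eps0; rewrite addr0.
    have e2 : 0 < eps / 2 by lra.
    move/cvg_rnormP/(_ _ e2) : ua => [K HK].
    pose m := maxn K (Num.truncn (2 / eps)).
    rewrite (le_trans (rnorm_tri _ (\sum_(i < n) u m i *: e i) _))//.
    rewrite (rnorm_distC (\sum_(i < n) u m i *: e i)).
    have := HK m (leq_maxl _ _).
    have : m.+1%:R^-1 < eps / 2.
      rewrite -[ltRHS]invrK ltf_pV2 ?posrE ?invr_gt0// invf_div.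
      by rewrite (lt_le_trans (truncnS_gt _))// ler_nat ltnS leq_maxr.
    by move=> h1 h2; have := lt_trans (Hu m) h1; lra.
  (* A vanishing combination with coefficient 1 at [n] contradicts independence. *)
  have := indep (fun j => if (j < n)%N then - a j else 1).
  rewrite big_ord_recr/= ltnn scale1r.
  under eq_bigr do rewrite ltn_ord scaleNr.
  rewrite sumrN -ea addNr => /(_ erefl n (ltnSn n)).
  by rewrite ltnn => /eqP; rewrite oner_eq0.
have last_le (c : nat -> R[i]) :
    rnorm (c n : R[i]^o) <= d^-1 * rnorm (\sum_(j < n.+1) c j *: e j).
  rewrite ler_pdivlMl//.
  have [->|cn0] := eqVneq (c n) 0; first by rewrite rnorm0 mulr0 rnorm_ge0.
  (* The whole sum is [c n] times the difference of [e n] and this combination of the earlier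
     vectors. *)
  have := Hd (fun j => - (c j / c n)).
  rewrite -(@ler_pM2l _ (rnorm (c n : R[i]^o))); last first.
    by rewrite lt0r rnorm_ge0 rnorm_eq0 cn0.
  rewrite -rnormZ mulrC => /le_trans; apply.
  rewrite scalerBr scaler_sumr -sumrN big_ord_recr/= addrC.
  under eq_bigr do rewrite scalerA -scaleNr mulrN opprK mulrCA divff// mulr1.
  by [].
exists (d^-1 + N * (1 + d^-1 * rnorm (e n))) => c i.
rewrite ltnS leq_eqVlt => /predU1P[->|ltin].
  rewrite (le_trans (last_le c))// ler_wpM2r ?rnorm_ge0// lerDl.
  by rewrite mulr_ge0// addr_ge0// mulr_ge0 ?rnorm_ge0// invr_ge0 ltW.
rewrite (le_trans (HM c i ltin))//.
set S := \sum_(j < n.+1) c j *: e j.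
have S_ge0 := rnorm_ge0 S.
have : rnorm (\sum_(j < n) c j *: e j) <= (1 + d^-1 * rnorm (e n)) * rnorm S.
  have -> : \sum_(j < n) c j *: e j = S - c n *: e n.
    by rewrite /S big_ord_recr/= addrK.
  rewrite (le_trans (rnormD _ _))// rnormN rnormZ mulrDl mul1r lerD2l.
  by rewrite mulrAC ler_wpM2r ?rnorm_ge0.
move=> /(ler_wpM2l M_ge0) /le_trans; apply.
by rewrite mulrA ler_wpM2r// lerDr invr_ge0 ltW.
Qed.

Lemma bounded_opP (R : realType) (V W : normedModType R[i]) (T : V -> W) :
  bounded_op T <->
  exists2 M : R, 0 < M & forall v, rnorm (T v) <= M * rnorm v.
Proof.
split=> [[M HM]|[M M0 HM]]; last first.
  by exists M%:C => v; rewrite !rnormE -rmorphM lecR.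
(* [M] is complex a priori; its modulus plus 1 is a strictly positive real bound. *)
exists (rnorm (M : R[i]^o) + 1) => [|v]; first by rewrite ltr_wpDl ?rnorm_ge0.
rewrite -lecR -rnormE rmorphM /= -rnormE (le_trans (HM v))//.
have : 0 <= M * `|v| by rewrite (le_trans _ (HM v)).
move=> /ger0_norm <-; rewrite normrM normr_id ler_wpM2r//.
by rewrite rmorphD /= -rnormE lerDl ler01.
Qed.

Definition packed_linear (R : realType) (V W : normedModType R[i])
    (f : V -> W) (lf : linear f) : {linear V -> W} :=
  HB.pack f (GRing.isLinear.Build _ _ _ _ _ lf).

(** A spanning family of minimal length is independent, since a nontrivial relation would allow one
    vector to be dropped. *)
Lemma finite_dimensional_basis (R : realType) (X : normedModType R[i]) :
  finite_dimensional X ->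
  exists (n : nat) (e : nat -> X),
    (forall x, exists c : nat -> R[i], x = \sum_(i < n) c i *: e i) /\
    (forall c : nat -> R[i], \sum_(i < n) c i *: e i = 0 ->
       forall i, (i < n)%N -> c i = 0).
Proof.
move=> fdX.
pose spanning n := `[< exists e : nat -> X,
  forall x, exists c : nat -> R[i], x = \sum_(i < n) c i *: e i >].
have exn : exists n, spanning n.
  case: fdX => n [e eX]; exists n; apply/asboolP.
  exists (fun i => if insub i is Some j then e j else 0) => x.
  have [c ->] := eX x.
  exists (fun i => if insub i is Some j then c j else 0).
  by apply: eq_bigr => i _; rewrite valK.
case: (ex_minnP exn) => -[|n] /asboolP[e eX] nmin; first by exists 0%N, e.
exists n.+1, e; split=> // c c0 j ltjn; apply: contrapT => /eqP cj0.
suff /nmin : spanning n by rewrite ltnn.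
apply/asboolP; exists (fun i => e (bump j i)) => x.
have [a ->] := eX x.
(* Subtracting [a j / c j] times the relation cancels the term at [j]; [bump j] enumerates the other
   indices. *)
exists (fun i => a (bump j i) - a j / c j * c (bump j i)).
transitivity (\sum_(i < n.+1) (a i - a j / c j * c i) *: e i).
  under [RHS]eq_bigr do rewrite scalerBl -scalerA.
  by rewrite sumrB -scaler_sumr c0 scaler0 subr0.
by rewrite (bigD1_ord (Ordinal ltjn))//= divfK// subrr scale0r add0r.
Qed.

(** Independence makes the chosen coordinates unique, hence linear; [independent_coords_bounded]
    bounds them. *)
Lemma bounded_coordinates (R : realType) (X : normedModType R[i]) :
  finite_dimensional X ->
  exists (n : nat) (e : 'I_n -> X) (f : 'I_n -> {linear X -> R[i]^o}),
    (forall i, bounded_op (f i)) /\ forall x, x = \sum_(i < n) f i x *: e i.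
Proof.
move=> /finite_dimensional_basis[n [e [eX eI]]].
have [M HM] := independent_coords_bounded eI.
have [c cE] := choice eX.
have c_linear (i : 'I_n) : linear (fun x => c x i : R[i]^o).
  move=> a x y; apply/eqP; rewrite -subr_eq0; apply/eqP.
  apply: (eI (fun j => c (a *: x + y) j - (a *: c x j + c y j))) => //.
  under eq_bigr do rewrite scalerBl scalerDl -scalerA.
  by rewrite sumrB big_split/= -scaler_sumr -!cE subrr.
exists n, e, (fun i => packed_linear (c_linear i)); split => // i.
exists M%:C => x; rewrite !rnormE -rmorphM lecR {2}(cE x).
exact: HM.
Qed.

(** * Riesz's criterion for finite dimension *)

(* The centre [e] of a half-ball containing [u] leaves a remainder of norm less
   than 1/2, so [u] is a series of terms [2^-k *: e_k] with every [e_k] among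
   finitely many vectors; grouping equal terms writes [u] as a finite
   combination, with no need to know that a finite-dimensional subspace is
   closed. *)
Lemma riesz_finite_dimensional (R : realType) (X : normedModType R[i])
    (s : seq X) :
  (forall u : X, rnorm u < 1 -> exists2 e, e \in s & rnorm (u - e) < 2^-1) ->
  finite_dimensional X.
Proof.
move=> Hs; pose n := size s; pose e (i : 'I_n) := nth 0 s i.
have net (u : X) : exists i, rnorm u < 1 -> rnorm (2 *: (u - e i)) < 1.
  (* Outside the unit ball any index will do; [Hs] at 0 shows that there is one. *)
  have [u1|nu1] := pselect (rnorm u < 1); last first.
    have [v vs _] := Hs 0 (eq_ind_r (fun t => t < 1) ltr01 (rnorm0 _)).
    have vn : (index v s < n)%N by rewrite index_mem.
    by exists (Ordinal vn).
  have [v vs hv] := Hs u u1.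
  have vn : (index v s < n)%N by rewrite index_mem.
  exists (Ordinal vn) => _; rewrite rnormZ /e/= nth_index//.
  rewrite -[2]/(2%:R) -(rmorph_nat (real_complex R)) rnorm_real.
  by rewrite ger0_norm// -ltr_pdivlMl// mulr1.
have [p Hp] := choice net.
have span1 (u : X) : rnorm u < 1 -> exists c : 'I_n -> R[i],
    u = \sum_(i < n) c i *: e i.
  (* [r k] is the remainder after [k] steps, scaled by 2^k, which stays in the unit ball; [a i k]
     sums the weights 2^-j of the steps j < k whose centre is [e i]. *)
  move=> u1; pose r k := iter k (fun v => 2 *: (v - e (p v))) u.
  have r1 k : rnorm (r k) < 1 by elim: k => [//|k IH]; exact: Hp.
  pose a i := series (fun k => 2^-1 ^+ k * (p (r k) == i)%:R : R).
  have uE k : u = \sum_(i < n) (a i k)%:C *: e i + (2^-1 ^+ k)%:C *: r k.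
    elim: k => [|k IH].
      rewrite expr0 scale1r big1 ?add0r// => i _.
      by rewrite /a /series/= big_geq// scale0r.
    rewrite {1}IH.
    have -> : \sum_(i < n) (a i k.+1)%:C *: e i =
        \sum_(i < n) (a i k)%:C *: e i + (2^-1 ^+ k)%:C *: e (p (r k)).
      rewrite -[X in _ = _ + X](_ : \sum_(i < n)
          (2^-1 ^+ k * (p (r k) == i)%:R)%:C *: e i = _); last first.
        rewrite (bigD1 (p (r k)))//= eqxx mulr1 big1 ?addr0// => i.
        by rewrite eq_sym => /negbTE ->; rewrite mulr0 scale0r.
      rewrite -big_split/=; apply: eq_bigr => i _.
      by rewrite -scalerDl -rmorphD /a /series/= big_nat_recr.
    rewrite -addrA; congr (_ + _).
    rewrite /= scalerA exprSr -[2]/(2%:R) -(rmorph_nat (real_complex R)).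
    by rewrite -rmorphM mulfVK// -scalerDr addrC subrK.
  have a_cvg i : exists l : R, a i @ \oo --> l.
    apply/cvg_ex.
    apply: (@series_le_cvg _ _ (geometric 1 2^-1)) => [k|k|k|].
    - by rewrite mulr_ge0// exprn_ge0// invr_ge0.
    - by rewrite /= mul1r exprn_ge0// invr_ge0.
    - rewrite /= mul1r ler_piMr ?exprn_ge0 ?invr_ge0//.
      by case: (_ == _).
    - by apply: is_cvg_geometric_series; rewrite ger0_norm; lra.
  have [l al] := choice a_cvg.
  exists (fun i => (l i)%:C).
  apply: (@cvg_unique _ (@norm_hausdorff _ X) (cst u @ \oo)).
    exact: cvg_cst.
  have -> : cst u = (fun k => \sum_(i < n) (a i k)%:C *: e i +
      (2^-1 ^+ k)%:C *: r k).
    by apply/funext => k; rewrite -uE.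
  rewrite -[\sum_(i < n) _]addr0; apply: cvgD.
    apply: (cvg_big (op := +%R)) => [|i _]; first exact: add_continuous.
    apply: cvgZr_tmp; apply/(@cvg_rnormP _ R[i]^o) => eps eps0.
    move/cvgrPdist_lt/(_ _ eps0) : (al i) => [K _ HK].
    exists K => k /HK/=.
    by rewrite -rmorphB rnorm_real.
  apply/cvg_rnormP => eps eps0.
  have : (fun k => 2^-1 ^+ k : R) @ \oo --> 0.
    by apply: cvg_expr; rewrite ger0_norm; lra.
  move/cvgrPdist_lt/(_ _ eps0) => [K _ HK].
  exists K => k /HK; rewrite /= !sub0r normrN rnormN rnormZ rnorm_real.
  by apply: le_lt_trans; rewrite ler_piMr// ltW.
exists n, e => x.
pose t := (rnorm x + 1)^-1.
have t0 : 0 < t by rewrite invr_gt0 ltr_wpDl ?rnorm_ge0.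
have [|c cE] := span1 (t%:C *: x).
  rewrite rnormZ rnorm_real gtr0_norm// mulrC ltr_pdivrMr ?mul1r ?ltrDl//.
  by rewrite -invr_gt0.
exists (fun i => t^-1%:C * c i).
under eq_bigr do rewrite -scalerA.
rewrite -scaler_sumr -cE scalerA -rmorphM mulVf ?scale1r//.
by rewrite gt_eqF.
Qed.

(** * Baire category *)

(** If no [F n] were dense in a ball, there would be nested closed balls with radii at most 2^-n,
    each new one missing the next [F n]; the limit of the centres would lie in no [F n]. *)
Lemma baire_cover (R : realType) (X : completeNormedModType R[i])
    (F : nat -> set X) :
  (forall x, exists n, F n x) ->
  exists n x (r : R), 0 < r /\ forall y, rnorm (y - x) < r ->
    forall eps : R, 0 < eps -> exists2 z, F n z & rnorm (y - z) < eps.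
Proof.
move=> cover; apply: contrapT => nowhere.
have shrink (q : nat * (X * R)) : exists q' : X * R, 0 < q.2.2 ->
    [/\ 0 < q'.2, q'.2 <= q.2.2 / 2,
        forall y, rnorm (y - q'.1) <= q'.2 -> rnorm (y - q.2.1) <= q.2.2 &
        forall z, F q.1 z -> q'.2 < rnorm (z - q'.1)].
  case: q => n [x r] /=.
  have [r0|nr0] := pselect (0 < r); last by exists (x, r).
  have [y yx [eps eps0 Hy]] : exists2 y, rnorm (y - x) < r &
      exists2 eps : R, 0 < eps & forall z, F n z -> eps <= rnorm (y - z).
    apply: contrapT => noy; apply: nowhere; exists n, x, r; split=> // y yx.
    move=> eps eps0; apply: contrapT => noz; apply: noy; exists y => //.
    exists eps => // z Fz; rewrite leNgt; apply/negP => h.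
    by apply: noz; exists z.
  pose d := r - rnorm (y - x).
  have d0 : 0 < d by rewrite subr_gt0.
  have dr : d <= r by rewrite lerBlDr lerDl rnorm_ge0.
  (* [eps / 2] keeps the closed ball off [F n]; [d / 2] keeps it inside the old ball, with at most
     half its radius. *)
  pose t := Num.min (eps / 2) (d / 2).
  have te : t <= eps / 2 by rewrite ge_min lexx.
  have td : t <= d / 2 by rewrite ge_min lexx orbT.
  exists (y, t) => _ /=; split=> [||w wy|z Fz].
  - by rewrite lt_min !divr_gt0.
  - lra.
  - by rewrite (le_trans (rnorm_tri _ y _))//; move: d0 td; rewrite /d; lra.
  - by have := Hy z Fz; rewrite rnorm_distC; lra.
have [f Hf] := choice shrink.
(* Starting from the unit ball, ball [k.+1] is the one that avoids [F k]. *)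
pose s := fix s n : X * R := if n is k.+1 then f (k, s k) else (0, 1).
have s_gt0 n : 0 < (s n).2 by elim: n => [|n IH] //=; case: (Hf (n, s n)).
have s_half n : (s n).2 <= 2^-1 ^+ n.
  elim: n => [|n IH]; first by rewrite expr0.
  by have [_ /= h _ _] := Hf (n, s n) (s_gt0 n); rewrite exprSr; lra.
have nested k j y : rnorm (y - (s (k + j)%N).1) <= (s (k + j)%N).2 ->
    rnorm (y - (s k).1) <= (s k).2.
  elim: j => [|j IH]; first by rewrite addn0.
  rewrite addnS => h; apply: IH.
  by have [_ _ /= + _] := Hf ((k + j)%N, s (k + j)%N) (s_gt0 _); apply.
have near_s k l : (k <= l)%N -> rnorm ((s l).1 - (s k).1) <= (s k).2.
  move=> /subnKC <-; apply: (nested _ (l - k)%N).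
  by rewrite subrr rnorm0 ltW.
have [x sx] : exists x : X, (fun n => (s n).1) @ \oo --> x.
  apply: rnorm_cauchy_cvg => e e0.
  have : (fun k => 2^-1 ^+ k : R) @ \oo --> 0.
    by apply: cvg_expr; rewrite ger0_norm; lra.
  have e2 : 0 < e / 2 by lra.
  move/cvgrPdist_lt/(_ _ e2) => [K _ HK].
  exists K => k l Kk Kl.
  have := HK K (leqnn K); rewrite /= sub0r normrN ger0_norm; last first.
    by rewrite exprn_ge0// invr_ge0.
  have := rnorm_tri (s k).1 (s K).1 (s l).1; rewrite (rnorm_distC (s K).1).
  by have := near_s _ _ Kk; have := near_s _ _ Kl; have := s_half K; lra.
have x_near k : rnorm (x - (s k).1) <= (s k).2.
  apply/ler_addgt0Pr => e e0.
  move/cvg_rnormP/(_ _ e0) : sx => [K HK].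
  have := HK (maxn K k) (leq_maxl _ _).
  have := near_s k (maxn K k) (leq_maxr _ _).
  by have := rnorm_tri x (s (maxn K k)).1 (s k).1; lra.
have [n Fx] := cover x.
have [_ _ _ /(_ x Fx)] := Hf (n, s n) (s_gt0 n).
by rewrite ltNge (x_near n.+1).
Qed.

(** * Precompact sets and compact operators *)

Lemma precompact_net (R : realType) (X : normedModType R[i]) (A : set X)
    (eps : R) : precompact A -> 0 < eps ->
  exists s : seq X, forall x, A x -> exists2 y, y \in s & rnorm (x - y) < eps.
Proof.
rewrite precompactE compact_cover => cA eps0.
have eps0' : 0 < eps%:C by rewrite ltcR.
have [//|x _|D _ AD] := cA X setT (fun x => ball x eps%:C).
- by move=> x _; exact: ball_open.
- by exists x => //; exact: ballxx.
exists (finmap.enum_fset D) => x /(@subset_closure _ A)/AD[y /= yD].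
by rewrite -ball_normE /= rnormE ltcR rnorm_distC; exists y.
Qed.

Lemma bounded_op_continuous (R : realType) (V W : normedModType R[i])
    (f : {linear V -> W}) : bounded_op f -> continuous f.
Proof.
move=> /bounded_opP[M M0 HM] x; apply/cvgrPdist_lt => e e0.
have eE : e = (complex.Re e)%:C by rewrite RRe_real// gtr0_real.
near=> y.
rewrite -linearB rnormE eE ltcR (le_lt_trans (HM _))// -ltr_pdivlMl//.
rewrite -ltcR -rnormE; near: y.
apply: cvgr_dist_lt => //.
by rewrite ltcR mulr_gt0// ?invr_gt0// -ltcR -eE.
Unshelve. all: by end_near. Qed.

Lemma precompact_image (R : realType) (V W : normedModType R[i])
    (f : V -> W) (A : set V) :
  continuous f -> precompact A -> precompact (f @` A).
Proof.
move=> cf; rewrite precompactE => cA.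
apply: (@precompact_subset _ _ (f @` closure A)).
  exact/image_subset/subset_closure.
apply: compact_precompact; first exact: norm_hausdorff.
by apply: continuous_compact => //; exact: continuous_subspaceT.
Qed.

Lemma compact_op_compl (R : realType) (V W U : normedModType R[i])
    (S : {linear W -> U}) (T : V -> W) :
  bounded_op S -> compact_op T -> compact_op (S \o T).
Proof.
move=> bS cT; rewrite /compact_op -image_comp.
by apply: precompact_image cT; exact: bounded_op_continuous.
Qed.

(** [S] maps the unit ball into the ball of radius [M], so the image lies in [M] times the image of
    the unit ball under [T]. *)
Lemma compact_op_compr (R : realType) (V W U : normedModType R[i])
    (S : V -> W) (T : {linear W -> U}) :
  bounded_op S -> compact_op T -> compact_op (T \o S).
Proof.
move=> /bounded_opP[M M0 HM] cT.
have cM : continuous (fun u : U => M%:C *: u).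
  by move=> u; apply: cvgZl_tmp; exact: cvg_id.
apply: precompact_subset (precompact_image cM cT) => _ [v /= v1 <-].
exists (T (M^-1%:C *: S v)); last first.
  by rewrite linearZ /= scalerA -rmorphM divff ?scale1r// gt_eqF.
exists (M^-1%:C *: S v) => //=.
rewrite rnormE -[1]/(1%:C) lecR rnormZ rnorm_real gtr0_norm ?invr_gt0//.
rewrite ler_pdivrMl// (le_trans (HM v))// ler_pM2l//.
by move: v1; rewrite rnormE -[1]/(1%:C) lecR.
Qed.

(** The image of a sum of two operators lies in the image under addition of a product of compact
    closures. *)
Lemma compact_op_sum (R : realType) (V W : normedModType R[i]) (I : Type)
    (r : seq I) (T : I -> V -> W) :
  (forall i, compact_op (T i)) -> compact_op (fun v => \sum_(i <- r) T i v).
Proof.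
move=> cT; elim: r => [|i r IH].
  apply: (@precompact_subset _ _ [set 0]) => [_ [v _ <-]|].
    by rewrite big_nil.
  by apply: compact_precompact; [exact: norm_hausdorff|exact: compact_set1].
have := cT i; rewrite /compact_op precompactE => ci.
move: IH; rewrite /compact_op precompactE => cr.
apply: (@precompact_subset _ _ ((fun p : W * W => p.1 + p.2) @`
    (closure (T i @` [set v | `|v| <= 1]) `*`
     closure ((fun v => \sum_(j <- r) T j v) @` [set v | `|v| <= 1])))).
  move=> _ [v v1 <-]; exists (T i v, \sum_(j <- r) T j v).
    by split; apply: subset_closure; exists v.
  by rewrite big_cons.
apply: compact_precompact; first exact: norm_hausdorff.
apply: continuous_compact; last exact: compact_setX.
apply: continuous_subspaceT; exact: add_continuous.
Qed.

(** * Finite dimension from a countable precompact cover *)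

Lemma compact_family_finite_dimensional (R : realType)
    (X : completeNormedModType R[i]) (F : nat -> set X) :
  (forall x, exists n, F n x) -> (forall n, precompact (F n)) ->
  finite_dimensional X.
Proof.
move=> /baire_cover[n [x [r [r0 dense_F]]]] /(_ n) cF.
(* Density and the net each cost less than [r / 4]; dividing by [r] turns the total into the 1/2 of
   the Riesz criterion. *)
have r4 : 0 < r / 4 by lra.
have [s Hs] := precompact_net cF r4.
apply: (@riesz_finite_dimensional _ _ [seq r^-1%:C *: (y - x) | y <- s]).
move=> u u1.
have [|z Fz uz] := dense_F (x + r%:C *: u) _ _ r4.
  by rewrite addrC addKr rnormZ rnorm_real gtr0_norm// gtr_pMr.
have [y ys zy] := Hs z Fz.
exists (r^-1%:C *: (y - x)); first exact: map_f.
have -> : u - r^-1%:C *: (y - x) = r^-1%:C *: ((x + r%:C *: u) - y).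
  rewrite !scalerBr scalerDr scalerA -rmorphM mulVf ?gt_eqF// scale1r.
  by rewrite opprB [RHS]addrAC [RHS]addrC.
rewrite rnormZ rnorm_real gtr0_norm ?invr_gt0// ltr_pdivrMl//.
by rewrite (le_lt_trans (rnorm_tri _ z _))//; lra.
Qed.

(** * Compactness of the weighted composition operators *)

Theorem proposition2 (R : realType) (X : completeNormedModType R[i])
    (hX : exists x : X, x != 0)
    (A B : spacePair R) (hA : admissible A) (hB : admissible B)
    (psi : disc R -> R[i]^o) (hpsi : analytic psi)
    (hpsi0 : exists z, psi z != 0)
    (phi : disc R -> disc R)
    (hphi : analytic (fun z => val (phi z) : R[i]^o)) :
  wcomp_compact psi phi (vectorSpace A X) (vectorSpace B X) <->
  finite_dimensional X /\
  wcomp_compact psi phi (scalarSpace A) (scalarSpace B).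
Proof.
case: hA => [/(_ 1)[one oneE] /(_ X)[tensorA dualA _]].
case: hB => [_ /(_ X)[tensorB dualB evalB]].
split=> [[T [TE cT]]|[/bounded_coordinates[n [e [f [bf fE]]]] [W [WE cW]]]].
  have fdX : finite_dimensional X.
    have const x : exists g, forall z, abs_fun (vectorSpace A X) g z = x.
      have [J [_ JE]] := tensorA x.
      by exists (J one) => z; rewrite JE oneE scale1r.
    have [S SE] := choice const.
    case: hpsi0 => z0 psi0.
    apply: (@compact_family_finite_dimensional _ _
      (fun n => [set x | rnorm (S x) <= n.+1%:R])) => [x|n].
      by exists (Num.truncn (rnorm (S x))); rewrite /= ltW// truncnS_gt.
    have ev_linear : linear (fun g => abs_fun (vectorSpace B X) g z0).
      by move=> a g h; rewrite linearP.
    (* Each [x] of the sublevel set is (n+1)/psi(z0) times the value at [z0] of the image of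
       S(x)/(n+1), which lies in the unit ball. *)
    have := compact_op_compl (S := packed_linear ev_linear) (evalB z0) cT.
    have c_cont : continuous (fun x : X => (n.+1%:R / psi z0 : R[i]) *: x).
      by move=> x; apply: cvgZl_tmp; exact: cvg_id.
    move=> /(precompact_image c_cont); apply: precompact_subset => x /= Sx.
    have n0 : n.+1%:R != 0 :> R[i] by rewrite pnatr_eq0.
    exists (psi z0 *: (n.+1%:R^-1 *: x)); last first.
      by rewrite !scalerA mulfVK// divff// scale1r.
    exists (n.+1%:R^-1 *: S x).
      rewrite /= normrZ normfV normr_nat ler_pdivrMl ?ltr0n// mulr1.
      by rewrite rnormE -(rmorph_nat (real_complex R)) lecR.
    by rewrite /= TE [abs_fun _ _]linearZ /= -[in RHS](SE x (phi z0)).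
  split=> //.
  have [n [e [f [bf fE]]]] := bounded_coordinates fdX.
  (* On the zero space the vector-valued operator is trivially compact and says nothing about the
     scalar one, so a nonzero vector is required here. *)
  case: hX => x0 x0_neq0.
  have [i fi0] : exists i, f i x0 != 0.
    apply: contrapT => fi0; move/eqP: x0_neq0; apply.
    rewrite (fE x0) big1// => i _; apply/eqP; rewrite scaler_eq0.
    by apply/orP; left; apply: contrapT => /negP h; apply: fi0; exists i.
  (* After this rescaling [f i] takes the value 1 on the vector, so [P \o (T \o J)] is the scalar
     operator. *)
  have [J [bJ JE]] := tensorA ((f i x0)^-1 *: x0).
  have [P [bP PE]] := dualB (f i) (bf i).
  exists (P \o (T \o J)); split=> [g z|]; last first.
    exact/compact_op_compl/compact_op_compr.
  rewrite /= PE TE JE !linearZ /=.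
  by rewrite /GRing.scale /= mulVf// mulr1.
(* [P i] extracts the [i]-th coordinate function and [J i] puts a scalar function back along [e i];
   [W] acts in between. *)
have [J HJ] := choice (fun i => tensorB (e i)).
have [P HP] := choice (fun i => dualA (f i) (bf i)).
have T_linear : linear (fun g => \sum_(i < n) J i (W (P i g))).
  move=> a g h; rewrite scaler_sumr -big_split /=.
  by apply: eq_bigr => i _; rewrite !linearP.
exists (packed_linear T_linear); split=> [g z|]; last first.
  apply: compact_op_sum => i.
  apply: (compact_op_compl (S := J i) (T := W \o P i)); first by case: (HJ i).
  by apply: compact_op_compr => //; case: (HP i).
rewrite /= linear_sum [X in _ = _ *: X]fE scaler_sumr.
rewrite fct_sumE; apply: eq_bigr => i _.
by have [_ ->] := HJ i; have [_ PE] := HP i; rewrite WE PE scalerA.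
Qed.
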